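(* For every finite group $G$ of odd order, there exists a subgroup of $B_\infty/[P_\infty,P_\infty]$ isomorphic to $G$. Moreover, $B_\infty/[P_\infty,P_\infty]$ contains no element of (finite) even order.
   Context: For $n\in\mathbb{N}$, $B_n$ is the standard (Artin) braid group on $n$ strands and $P_n$ is the pure braid group on $n$ strands, i.e. the kernel of the natural map $B_n\to\mathfrak{S}_n$ to the symmetric group. $B_\infty$ is the direct limit of the groups $B_n$ along the maps $B_n\to B_{n+1}$ adding one strand on the right, and $P_\infty\subset B_\infty$ is the direct limit of the groups $P_n$ along the same maps. *)

(* Defs.v *)
From HB Require Import structures.
From mathcomp Require Import all_boot.
From mathcomp Require Import fingroup perm.
From mathcomp Require Import boolp generic_quotient.

Set Implicit Arguments.
Unset Strict Implicit.
Unset Printing Implicit Defensive.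

Local Open Scope group_scope.
Local Open Scope quotient_scope.

(** A word is a sequence of letters [(x, b)]: [(x, false)] stands for the
    generator [x] and [(x, true)] for its formal inverse. *)
Definition word (X : Type) := seq (X * bool).

Definition word_inv (X : Type) (w : word X) : word X :=
  rev [seq (l.1, ~~ l.2) | l <- w].

Inductive pres_eq (X : Type) (R : word X -> word X -> Prop) :
    word X -> word X -> Prop :=
| pres_eq_rel u v : R u v -> pres_eq R u v
| pres_eq_cancel x b : pres_eq R [:: (x, b); (x, ~~ b)] [::]
| pres_eq_cat u u' v v' :
    pres_eq R u u' -> pres_eq R v v' -> pres_eq R (u ++ v) (u' ++ v')
| pres_eq_refl u : pres_eq R u u
| pres_eq_sym u v : pres_eq R u v -> pres_eq R v u
| pres_eq_trans v u w : pres_eq R u v -> pres_eq R v w -> pres_eq R u w.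

Section Presentation.
Variables (X : choiceType) (R : word X -> word X -> Prop).

Definition pres_eqb : rel (word X) := fun u v => `[< pres_eq R u v >].

Fact pres_eqb_refl : reflexive pres_eqb.
Proof. by move=> u; apply/asboolP; apply: pres_eq_refl. Qed.

Fact pres_eqb_sym : symmetric pres_eqb.
Proof. by move=> u v; apply/asboolP/asboolP; apply: pres_eq_sym. Qed.

Fact pres_eqb_trans : transitive pres_eqb.
Proof.
move=> v u w /asboolP uv /asboolP vw; apply/asboolP.
exact: pres_eq_trans uv vw.
Qed.

Canonical pres_equiv := EquivRel pres_eqb pres_eqb_refl pres_eqb_sym
  pres_eqb_trans.

Definition presented := {eq_quot pres_eqb}.
HB.instance Definition _ := Choice.on presented.
HB.instance Definition _ := EqQuotient.on presented.

Definition pres_class (w : word X) : presented := \pi_presented w.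

Definition pres_gen (x : X) : presented := pres_class [:: (x, false)].

Lemma pres_classP u v : pres_class u = pres_class v <-> pres_eq R u v.
Proof.
split=> [/eqP|uv]; last by apply/eqP; rewrite eqquotE; apply/asboolP.
by rewrite eqquotE => /asboolP.
Qed.

Lemma pres_classW (P : presented -> Prop) :
  (forall w, P (pres_class w)) -> forall x, P x.
Proof. exact: quotW. Qed.

Lemma pres_eq_repr w : pres_eq R (repr (pres_class w)) w.
Proof. by apply/pres_classP; rewrite /pres_class reprK. Qed.

Lemma pres_eq_invr w : pres_eq R (w ++ word_inv w) [::].
Proof.
elim: w => [|[x b] w IHw]; first exact: pres_eq_refl.
rewrite /word_inv /= rev_cons -/(word_inv w) -cats1 catA.
apply: pres_eq_trans (pres_eq_cancel R x b).
apply: (@pres_eq_cat _ _ [:: (x, b)] [:: (x, b)]); first exact: pres_eq_refl.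
by apply: (@pres_eq_cat _ _ _ [::]) => //; apply: pres_eq_refl.
Qed.

Lemma word_invK : involutive (@word_inv X).
Proof.
move=> w; rewrite /word_inv map_rev revK -map_comp -[RHS]map_id.
by apply: eq_map => -[x b] /=; rewrite negbK.
Qed.

Lemma pres_eq_invl w : pres_eq R (word_inv w ++ w) [::].
Proof. by rewrite -{2}(word_invK w); apply: pres_eq_invr. Qed.

Lemma pres_eq_inv u v : pres_eq R u v -> pres_eq R (word_inv u) (word_inv v).
Proof.
move=> uv; apply: (@pres_eq_trans _ _ (word_inv u ++ (v ++ word_inv v))).
  rewrite -[X in pres_eq R X _]cats0.
  apply: pres_eq_cat; first exact: pres_eq_refl.
  exact/pres_eq_sym/pres_eq_invr.
rewrite catA -[X in pres_eq R _ X]cat0s.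
apply: pres_eq_cat; last exact: pres_eq_refl.
apply: pres_eq_trans (pres_eq_invl u).
by apply: pres_eq_cat; [exact: pres_eq_refl | exact: pres_eq_sym].
Qed.

Definition pres_one : presented := pres_class [::].
Definition pres_mul (x y : presented) : presented :=
  pres_class (repr x ++ repr y).
Definition pres_inv (x : presented) : presented :=
  pres_class (word_inv (repr x)).

Fact pres_mulE u v :
  pres_mul (pres_class u) (pres_class v) = pres_class (u ++ v).
Proof. by apply/pres_classP/pres_eq_cat; apply: pres_eq_repr. Qed.

Fact pres_invE u : pres_inv (pres_class u) = pres_class (word_inv u).
Proof. exact/pres_classP/pres_eq_inv/pres_eq_repr. Qed.

Fact pres_mulA : associative pres_mul.
Proof.
elim/pres_classW=> u; elim/pres_classW=> v; elim/pres_classW=> w.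
by rewrite !pres_mulE catA.
Qed.

Fact pres_mul1 : left_id pres_one pres_mul.
Proof. by elim/pres_classW=> u; rewrite pres_mulE. Qed.

Fact pres_mulr1 : right_id pres_one pres_mul.
Proof. by elim/pres_classW=> u; rewrite pres_mulE cats0. Qed.

Fact pres_mulV : left_inverse pres_one pres_inv pres_mul.
Proof.
elim/pres_classW=> u; rewrite pres_invE pres_mulE.
exact/pres_classP/pres_eq_invl.
Qed.

Fact pres_mulrV : right_inverse pres_one pres_inv pres_mul.
Proof.
elim/pres_classW=> u; rewrite pres_invE pres_mulE.
exact/pres_classP/pres_eq_invr.
Qed.

HB.instance Definition _ := isGroup.Build presented
  pres_mulA pres_mul1 pres_mulr1 pres_mulV pres_mulrV.

Lemma pres_classM u v : pres_class (u ++ v) = pres_class u * pres_class v.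
Proof. by rewrite -pres_mulE. Qed.

Lemma pres_class_inv u : pres_class (word_inv u) = (pres_class u)^-1.
Proof. by rewrite -pres_invE. Qed.

End Presentation.

Section PresentationLift.
Variables (X : choiceType) (R : word X -> word X -> Prop).
Variables (H : groupType) (f : X -> H).

Definition word_eval (w : word X) : H :=
  \prod_(l <- w) (if l.2 then (f l.1)^-1 else f l.1).

(** The homomorphism out of a presented group that is determined by the images
    [f] of the generators; meaningful only if [f] satisfies the relations. *)
Definition pres_lift (x : presented R) : H := word_eval (repr x).

Lemma word_eval_cat u v : word_eval (u ++ v) = word_eval u * word_eval v.
Proof. exact: big_cat. Qed.

Hypothesis fR : forall u v, R u v -> word_eval u = word_eval v.

Lemma word_eval_eq u v : pres_eq R u v -> word_eval u = word_eval v.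
Proof.
elim=> {u v} [//|x b|u u' v v' _ IHu _ IHv|//|//|v u w _ -> _ -> //].
- rewrite /word_eval !big_cons big_nil mulg1.
  by case: b; rewrite /= (mulVg, mulgV).
- by rewrite !word_eval_cat IHu IHv.
Qed.

Lemma pres_liftE w : pres_lift (pres_class R w) = word_eval w.
Proof. exact/word_eval_eq/pres_eq_repr. Qed.

Lemma pres_liftM : {morph pres_lift : x y / x * y}.
Proof.
elim/pres_classW=> u; elim/pres_classW=> v.
by rewrite -pres_classM !pres_liftE word_eval_cat.
Qed.

Lemma pres_lift_gen x : pres_lift (pres_gen R x) = f x.
Proof. by rewrite pres_liftE /word_eval big_cons big_nil mulg1. Qed.

End PresentationLift.

Record groupSystem := GroupSystem {
  sys_obj :> nat -> groupType;
  sys_map : forall n m, n <= m -> sys_obj n -> sys_obj m;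
  sys_mapM : forall n m (h : n <= m), {morph sys_map h : x y / x * y};
  sys_map_id : forall n (h : n <= n) x, sys_map h x = x;
  sys_map_comp : forall n m k (h : n <= m) (h' : m <= k) (h'' : n <= k) x,
    sys_map h' (sys_map h x) = sys_map h'' x
}.

Section DirectLimit.
Variable S : groupSystem.

Definition dl_pre := {n : nat & S n}.
HB.instance Definition _ := Choice.on dl_pre.

Definition dl_eqb : rel dl_pre := fun a b =>
  `[< exists k (ha : tag a <= k) (hb : tag b <= k),
        sys_map ha (tagged a) = sys_map hb (tagged b) >].

Fact dl_eqb_refl : reflexive dl_eqb.
Proof. by move=> a; apply/asboolP; exists (tag a), (leqnn _), (leqnn _). Qed.

Fact dl_eqb_sym : symmetric dl_eqb.
Proof. by move=> a b; apply/asboolP/asboolP=> -[k [h [h' e]]]; exists k, h', h. Qed.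

Fact dl_eqb_trans : transitive dl_eqb.
Proof.
move=> b a c /asboolP[k [ha [hb e]]] /asboolP[l [hb' [hc e']]]; apply/asboolP.
have hk := leq_maxl k l; have hl := leq_maxr k l.
exists (maxn k l), (leq_trans ha hk), (leq_trans hc hl).
rewrite -(sys_map_comp ha hk) -(sys_map_comp hc hl) e -e'.
by rewrite !(sys_map_comp _ _ (leq_trans hb hk)).
Qed.

Canonical dl_equiv := EquivRel dl_eqb dl_eqb_refl dl_eqb_sym dl_eqb_trans.

Definition dirlim := {eq_quot dl_eqb}.
HB.instance Definition _ := Choice.on dirlim.
HB.instance Definition _ := EqQuotient.on dirlim.

Definition dl_in n (x : S n) : dirlim :=
  \pi_dirlim (Tagged (fun n => S n) x : dl_pre).

Lemma dl_inP n m (x : S n) (y : S m) :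
  dl_in x = dl_in y <->
  exists k (hn : n <= k) (hm : m <= k), sys_map hn x = sys_map hm y.
Proof.
split=> [/eqP|e]; last by apply/eqP; rewrite eqquotE; apply/asboolP.
by rewrite eqquotE => /asboolP.
Qed.

Lemma dl_inW (P : dirlim -> Prop) :
  (forall n (x : S n), P (dl_in x)) -> forall a, P a.
Proof. by move=> hP; apply: quotW => -[n x]; apply: hP. Qed.

Lemma dl_in_map n m (h : n <= m) (x : S n) : dl_in (sys_map h x) = dl_in x.
Proof.
by apply/dl_inP; exists m, (leqnn m), h; rewrite sys_map_id.
Qed.

Lemma sys_map1 n m (h : n <= m) : sys_map h (1 : S n) = 1.
Proof. by apply: (mulgI (sys_map h 1)); rewrite -sys_mapM !mulg1. Qed.

Lemma sys_mapV n m (h : n <= m) (x : S n) : sys_map h x^-1 = (sys_map h x)^-1.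
Proof. by apply: (mulgI (sys_map h x)); rewrite -sys_mapM !mulgV sys_map1. Qed.

Definition dl_one : dirlim := dl_in (1 : S 0).

Definition dl_mul (a b : dirlim) : dirlim :=
  dl_in (sys_map (leq_maxl _ _) (tagged (repr a)) *
         sys_map (leq_maxr _ _) (tagged (repr b))).

Definition dl_inv (a : dirlim) : dirlim := dl_in (tagged (repr a))^-1.

Lemma dl_in_repr (a : dirlim) : dl_in (tagged (repr a)) = a.
Proof. by rewrite /dl_in taggedK reprK. Qed.

Fact dl_mul_map n m k (hn : n <= k) (hm : m <= k) (x : S n) (y : S m) :
  dl_mul (dl_in x) (dl_in y) = dl_in (sys_map hn x * sys_map hm y).
Proof.
rewrite /dl_mul.
have := dl_in_repr (dl_in x); case: (repr (dl_in x)) => n' x' /=.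
have := dl_in_repr (dl_in y); case: (repr (dl_in y)) => m' y' /=.
move=> /dl_inP[p [hm'p [hmp ey]]] /dl_inP[q [hn'q [hnq ex]]].
have hp : p <= p + q + k + maxn n' m' by rewrite -!addnA leq_addr.
have hq : q <= p + q + k + maxn n' m' by rewrite -!addnA (addnCA p) leq_addr.
have hk : k <= p + q + k + maxn n' m' by rewrite -addnA addnCA leq_addr.
have hM : maxn n' m' <= p + q + k + maxn n' m' by rewrite leq_addl.
apply/dl_inP; exists _, hM, hk; rewrite !sys_mapM.
congr (_ * _).
- rewrite (sys_map_comp _ _ (leq_trans hn'q hq)) (sys_map_comp _ _ (leq_trans hnq hq)).
  by rewrite -(sys_map_comp hn'q hq) -(sys_map_comp hnq hq) ex.
- rewrite (sys_map_comp _ _ (leq_trans hm'p hp)) (sys_map_comp _ _ (leq_trans hmp hp)).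
  by rewrite -(sys_map_comp hm'p hp) -(sys_map_comp hmp hp) ey.
Qed.

Fact dl_mul_in n (x y : S n) : dl_mul (dl_in x) (dl_in y) = dl_in (x * y).
Proof. by rewrite (dl_mul_map (leqnn n) (leqnn n)) !sys_map_id. Qed.

Fact dl_inv_in n (x : S n) : dl_inv (dl_in x) = dl_in x^-1.
Proof.
rewrite /dl_inv.
have := dl_in_repr (dl_in x); case: (repr (dl_in x)) => n' x' /=.
move=> /dl_inP[k [h' [h e]]]; apply/dl_inP; exists k, h', h.
by rewrite !sys_mapV e.
Qed.

Fact dl_one_in n : dl_one = dl_in (1 : S n).
Proof. by rewrite -[RHS](congr1 (@dl_in n) (sys_map1 (leq0n n))) dl_in_map. Qed.

Lemma dl_in2W (P : dirlim -> dirlim -> Prop) :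
  (forall n (x y : S n), P (dl_in x) (dl_in y)) -> forall a b, P a b.
Proof.
move=> hP; elim/dl_inW=> n x; elim/dl_inW=> m y.
by rewrite -(dl_in_map (leq_maxl n m) x) -(dl_in_map (leq_maxr n m) y).
Qed.

Fact dl_mulA : associative dl_mul.
Proof.
move=> a b c; elim/dl_inW: c => m z; move: a b; apply: dl_in2W => n x y.
rewrite -(dl_in_map (leq_maxl n m) x) -(dl_in_map (leq_maxl n m) y).
by rewrite -(dl_in_map (leq_maxr n m) z) !dl_mul_in mulgA.
Qed.

Fact dl_mul1 : left_id dl_one dl_mul.
Proof. by elim/dl_inW=> n x; rewrite (dl_one_in n) dl_mul_in mul1g. Qed.

Fact dl_mulr1 : right_id dl_one dl_mul.
Proof. by elim/dl_inW=> n x; rewrite (dl_one_in n) dl_mul_in mulg1. Qed.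

Fact dl_mulV : left_inverse dl_one dl_inv dl_mul.
Proof.
by elim/dl_inW=> n x; rewrite (dl_one_in n) dl_inv_in dl_mul_in mulVg.
Qed.

Fact dl_mulrV : right_inverse dl_one dl_inv dl_mul.
Proof.
by elim/dl_inW=> n x; rewrite (dl_one_in n) dl_inv_in dl_mul_in mulgV.
Qed.

HB.instance Definition _ := isGroup.Build dirlim
  dl_mulA dl_mul1 dl_mulr1 dl_mulV dl_mulrV.

Lemma dl_inM n : {morph @dl_in n : x y / x * y}.
Proof. by move=> x y; rewrite -dl_mul_in. Qed.

Lemma dl_inV n (x : S n) : dl_in x^-1 = (dl_in x)^-1.
Proof. by rewrite -dl_inv_in. Qed.

Lemma dl_in1 n : dl_in (1 : S n) = 1.
Proof. by rewrite -dl_one_in. Qed.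

End DirectLimit.

Definition gen_sub (G : groupType) (A : {pred G}) : {pred G} :=
  [pred x | `[< forall H : {pred G},
                  group_closed H -> {subset A <= H} -> x \in H >]].

Definition comm_sub (G : groupType) (A : {pred G}) : {pred G} :=
  gen_sub [pred z | `[< exists x y, [/\ x \in A, y \in A & z = [~ x, y]] >]].

Record normalSub (G : groupType) := NormalSub {
  nsub :> {pred G};
  nsub_closed : group_closed nsub;
  nsubJ : forall x y, x \in nsub -> x ^ y \in nsub
}.

Section QuotientGroup.
Variables (G : groupType) (N : normalSub G).

Lemma nsub1 : 1 \in (N : {pred G}).
Proof. by have [] := nsub_closed N. Qed.

Lemma nsubF x y : x \in (N : {pred G}) -> y \in (N : {pred G}) ->
  x / y \in (N : {pred G}).
Proof. by have [_] := nsub_closed N; apply. Qed.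

Lemma nsubV x : x \in (N : {pred G}) -> x^-1 \in (N : {pred G}).
Proof. by move=> Nx; rewrite -[x^-1]mul1g nsubF // nsub1. Qed.

Lemma nsubM x y : x \in (N : {pred G}) -> y \in (N : {pred G}) ->
  x * y \in (N : {pred G}).
Proof. by move=> Nx Ny; rewrite -[y]invgK nsubF // nsubV. Qed.

Definition qg_eqb : rel G := fun x y => x^-1 * y \in (N : {pred G}).

Fact qg_eqb_refl : reflexive qg_eqb.
Proof. by move=> x; rewrite /qg_eqb mulVg nsub1. Qed.

Fact qg_eqb_sym : symmetric qg_eqb.
Proof.
by move=> x y; apply/idP/idP => /nsubV; rewrite invgM invgK.
Qed.

Fact qg_eqb_trans : transitive qg_eqb.
Proof.
move=> y x z xy yz; have := nsubM xy yz.
by rewrite mulgA mulgK.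
Qed.

Canonical qg_equiv := EquivRel qg_eqb qg_eqb_refl qg_eqb_sym qg_eqb_trans.

Definition quotg := {eq_quot qg_eqb}.
HB.instance Definition _ := Choice.on quotg.
HB.instance Definition _ := EqQuotient.on quotg.

Definition qg_class (x : G) : quotg := \pi_quotg x.

Lemma qg_classP x y : qg_class x = qg_class y <-> x^-1 * y \in (N : {pred G}).
Proof. by split=> [/eqP|xy]; last apply/eqP; rewrite eqquotE. Qed.

Lemma qg_classW (P : quotg -> Prop) : (forall x, P (qg_class x)) -> forall a, P a.
Proof. exact: quotW. Qed.

Lemma qg_repr (x : G) : (repr (qg_class x))^-1 * x \in (N : {pred G}).
Proof. by apply/qg_classP; rewrite /qg_class reprK. Qed.

Definition qg_one : quotg := qg_class 1.
Definition qg_mul (a b : quotg) : quotg := qg_class (repr a * repr b).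
Definition qg_inv (a : quotg) : quotg := qg_class (repr a)^-1.

Fact qg_mulE x y : qg_mul (qg_class x) (qg_class y) = qg_class (x * y).
Proof.
set x' := repr (qg_class x); set y' := repr (qg_class y).
have Nx : x'^-1 * x \in (N : {pred G}) := qg_repr x.
have Ny : y'^-1 * y \in (N : {pred G}) := qg_repr y.
apply/qg_classP; have := nsubM (nsubJ y' Nx) Ny.
by rewrite /conjg invgM !mulgA mulgK.
Qed.

Fact qg_invE x : qg_inv (qg_class x) = qg_class x^-1.
Proof.
set x' := repr (qg_class x).
have Nx : x'^-1 * x \in (N : {pred G}) := qg_repr x.
apply/qg_classP; have := nsubV (nsubJ x'^-1 Nx).
by rewrite /conjg !invgK !mulgA mulgV mul1g invgM invgK.
Qed.

Fact qg_mulA : associative qg_mul.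
Proof.
elim/qg_classW=> x; elim/qg_classW=> y; elim/qg_classW=> z.
by rewrite !qg_mulE mulgA.
Qed.

Fact qg_mul1 : left_id qg_one qg_mul.
Proof. by elim/qg_classW=> x; rewrite qg_mulE mul1g. Qed.

Fact qg_mulr1 : right_id qg_one qg_mul.
Proof. by elim/qg_classW=> x; rewrite qg_mulE mulg1. Qed.

Fact qg_mulV : left_inverse qg_one qg_inv qg_mul.
Proof. by elim/qg_classW=> x; rewrite qg_invE qg_mulE mulVg. Qed.

Fact qg_mulrV : right_inverse qg_one qg_inv qg_mul.
Proof. by elim/qg_classW=> x; rewrite qg_invE qg_mulE mulgV. Qed.

HB.instance Definition _ := isGroup.Build quotg
  qg_mulA qg_mul1 qg_mulr1 qg_mulV qg_mulrV.

Lemma qg_classM : {morph qg_class : x y / x * y}.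
Proof. by move=> x y; rewrite -qg_mulE. Qed.

Lemma qg_class_eq1 x : qg_class x = 1 <-> x \in (N : {pred G}).
Proof.
rewrite -[1]/(qg_class 1); split=> [/esym|Nx].
  by move=> /qg_classP; rewrite invg1 mul1g.
by apply/esym/qg_classP; rewrite invg1 mul1g.
Qed.

End QuotientGroup.

Lemma comm_sub_closed (G : groupType) (A : {pred G}) :
  group_closed (comm_sub A).
Proof.
split; first by apply/asboolP=> H [].
move=> x y /asboolP Ax /asboolP Ay; apply/asboolP=> H cH sAH.
by have [_] := cH; apply; [apply: Ax | apply: Ay].
Qed.

Lemma comm_subJ (G : groupType) (A : {pred G}) :
  (forall x y, x \in A -> x ^ y \in A) ->
  forall x y, x \in comm_sub A -> x ^ y \in comm_sub A.
Proof.
move=> nA x y /asboolP Ax; apply/asboolP=> H cH sAH.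
pose K : {pred G} := [pred z | z ^ y \in H].
suff: x \in K by [].
have [H1 HF] := cH.
apply: Ax.
  split; first by rewrite inE conj1g.
  by move=> u v; rewrite !inE conjMg conjVg; apply: HF.
move=> z /asboolP[a [b [Aa Ab ->]]]; rewrite inE; apply: sAH.
by apply/asboolP; exists (a ^ y), (b ^ y); rewrite conjRg; split=> //; apply: nA.
Qed.

(** The generator of index [i : 'I_n.-1] is the standard [sigma_(i+1)]
    exchanging the strands [i] and [i+1], the strands being numbered from 0. *)
Inductive braid_rel (n : nat) : word 'I_n.-1 -> word 'I_n.-1 -> Prop :=
| braid_rel_comm (i j : 'I_n.-1) : i.+1 < j ->
    braid_rel [:: (i, false); (j, false)] [:: (j, false); (i, false)]
| braid_rel_braid (i j : 'I_n.-1) : j = i.+1 :> nat ->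
    braid_rel [:: (i, false); (j, false); (i, false)]
              [:: (j, false); (i, false); (j, false)].

Definition braid (n : nat) := presented (@braid_rel n).
HB.instance Definition _ n := Group.on (braid n).

Definition sigma n (i : 'I_n.-1) : braid n := pres_gen (@braid_rel n) i.

Lemma sigma_comm n (i j : 'I_n.-1) : i.+1 < j ->
  sigma i * sigma j = sigma j * sigma i.
Proof.
move=> ij; rewrite -!pres_classM; apply/pres_classP/pres_eq_rel.
exact: braid_rel_comm.
Qed.

Lemma sigma_braid n (i j : 'I_n.-1) : j = i.+1 :> nat ->
  sigma i * sigma j * sigma i = sigma j * sigma i * sigma j.
Proof.
move=> ij.
rewrite -(pres_classM _ [:: (i, false)] [:: (j, false)]).
rewrite -(pres_classM _ [:: (j, false)] [:: (i, false)]) -!pres_classM.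
by apply/pres_classP/pres_eq_rel; apply: braid_rel_braid.
Qed.

Section BraidLift.
Variables (n : nat) (H : groupType) (f : 'I_n.-1 -> H).
Hypothesis fcomm : forall i j : 'I_n.-1, i.+1 < j -> f i * f j = f j * f i.
Hypothesis fbraid : forall i j : 'I_n.-1, j = i.+1 :> nat ->
  f i * f j * f i = f j * f i * f j.

Lemma braid_liftP u v : braid_rel u v -> word_eval f u = word_eval f v.
Proof.
by case=> i j ij; rewrite /word_eval !big_cons big_nil /= !mulg1 ?mulgA;
  [apply: fcomm | apply: fbraid].
Qed.

End BraidLift.

Fact leq_pred2 n m : n <= m -> n.-1 <= m.-1.
Proof. by case: n m => [|n] [|m]. Qed.

(** The map adding [m - n] strands on the right *)
Definition braid_incl n m (h : n <= m) : braid n -> braid m :=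
  pres_lift (fun i : 'I_n.-1 =>
    sigma (widen_ord (leq_pred2 h : n.-1 <= m.-1) i)).

Fact braid_incl_rel n m (h : n <= m) u v : @braid_rel n u v ->
  word_eval (fun i => sigma (widen_ord (leq_pred2 h) i)) u =
  word_eval (fun i => sigma (widen_ord (leq_pred2 h) i)) v.
Proof.
by apply: braid_liftP => i j ij; [apply: sigma_comm | apply: sigma_braid].
Qed.

Lemma braid_incl_sigma n m (h : n <= m) i :
  braid_incl h (sigma i) = sigma (widen_ord (leq_pred2 h) i).
Proof. exact/pres_lift_gen/braid_incl_rel. Qed.

Lemma braid_inclM n m (h : n <= m) : {morph braid_incl h : x y / x * y}.
Proof. exact/pres_liftM/braid_incl_rel. Qed.

Definition word_widen n m (h : n <= m) (w : word 'I_n.-1) : word 'I_m.-1 :=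
  [seq (widen_ord (leq_pred2 h) l.1, l.2) | l <- w].

Lemma braid_inclE n m (h : n <= m) w :
  braid_incl h (pres_class _ w) = pres_class _ (word_widen h w).
Proof.
rewrite /braid_incl pres_liftE; last exact: braid_incl_rel.
elim: w => [|[i b] w IHw] /=; first by rewrite /word_eval big_nil.
rewrite -cat1s word_eval_cat IHw.
rewrite -(cat1s (_, b) (word_widen h w)) [RHS]pres_classM.
congr (_ * _); rewrite /word_eval big_cons big_nil mulg1 /=.
by case: b => //; rewrite -pres_class_inv.
Qed.

Fact braid_incl_id n (h : n <= n) x : braid_incl h x = x.
Proof.
elim/pres_classW: x => w; rewrite braid_inclE /word_widen.
congr pres_class; rewrite -[RHS]map_id; apply: eq_map => -[i b] /=.
by congr (_, _); apply: val_inj.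
Qed.

Fact braid_incl_comp n m k (h : n <= m) (h' : m <= k) (h'' : n <= k) x :
  braid_incl h' (braid_incl h x) = braid_incl h'' x.
Proof.
elim/pres_classW: x => w; rewrite !braid_inclE /word_widen -map_comp.
by congr pres_class; apply: eq_map => -[i b] /=; congr (_, _); apply: val_inj.
Qed.

Definition braid_system : groupSystem :=
  @GroupSystem (fun n => braid n : groupType) braid_incl
    braid_inclM braid_incl_id braid_incl_comp.

Definition Binf := dirlim braid_system.
HB.instance Definition _ := Group.on Binf.

Definition braid_Binf n (x : braid n) : Binf := dl_in (x : braid_system n).

Fact strand_lo_subproof n (i : 'I_n.-1) : i < n.
Proof. exact: leq_trans (ltn_ord i) (leq_pred n). Qed.

Fact strand_hi_subproof n (i : 'I_n.-1) : i.+1 < n.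
Proof. by rewrite -ltn_predRL. Qed.

Definition strand_lo n (i : 'I_n.-1) : 'I_n := Ordinal (strand_lo_subproof i).
Definition strand_hi n (i : 'I_n.-1) : 'I_n := Ordinal (strand_hi_subproof i).

Definition braid_perm n : braid n -> 'S_n :=
  pres_lift (fun i : 'I_n.-1 => tperm (strand_lo i) (strand_hi i)).

Fact braid_perm_rel n u v : @braid_rel n u v ->
  word_eval (fun i => tperm (strand_lo i) (strand_hi i)) u =
  word_eval (fun i => tperm (strand_lo i) (strand_hi i)) v.
Proof.
apply: braid_liftP => i j ij.
  have lij := ltnW ij.
  by rewrite conjgC tpermJ !tpermD // -val_eqE /= gtn_eqF // ltnS ltnW.
have eqS : strand_lo j = strand_hi i by apply: val_inj.
have nlo : strand_lo i != strand_hi j by rewrite -val_eqE /= ij neq_ltn ltnW.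
have nhi : strand_hi i != strand_hi j by rewrite -val_eqE /= ij neq_ltn ltnSn.
have nlh : strand_lo i != strand_hi i by rewrite -val_eqE /= neq_ltn ltnSn.
set a := tperm (strand_lo i) _; set b := tperm (strand_lo j) _.
have -> : a * b * a = b ^ a by rewrite /conjg tpermV mulgA.
have -> : b * a * b = a ^ b by rewrite /conjg tpermV mulgA.
rewrite /a /b !tpermJ eqS tpermR tpermL (tpermD nlo nhi).
by rewrite tpermD // eq_sym.
Qed.

Lemma braid_permM n : {morph @braid_perm n : x y / x * y}.
Proof. exact/pres_liftM/braid_perm_rel. Qed.

Lemma braid_perm_sigma n (i : 'I_n.-1) :
  braid_perm (sigma i) = tperm (strand_lo i) (strand_hi i).
Proof. exact/pres_lift_gen/braid_perm_rel. Qed.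

Definition pure n : {pred braid n} := [pred x | braid_perm x == 1].

(** The limit of the [pure n], as the subgroup of [Binf] formed by the images
    of all pure braids *)
Definition Pinf : {pred Binf} :=
  [pred x | `[< exists n (y : braid n), y \in @pure n /\ x = braid_Binf y >]].

Lemma braid_perm1 n : braid_perm (1 : braid n) = 1.
Proof. by apply: (mulgI (braid_perm 1)); rewrite -braid_permM !mulg1. Qed.

Lemma braid_permV n (x : braid n) : braid_perm x^-1 = (braid_perm x)^-1.
Proof.
by apply: (mulgI (braid_perm x)); rewrite -braid_permM !mulgV braid_perm1.
Qed.

Lemma braid_perm_class n w : braid_perm (pres_class (@braid_rel n) w) =
  word_eval (fun i => tperm (strand_lo i) (strand_hi i)) w.
Proof. exact/pres_liftE/braid_perm_rel. Qed.

Lemma braid_perm_incl n m (h : n <= m) (x : braid n) (k : 'I_n) :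
  braid_perm (braid_incl h x) (widen_ord h k) = widen_ord h (braid_perm x k).
Proof.
elim/pres_classW: x => w; rewrite braid_inclE !braid_perm_class.
elim: w k => [|[i b] w IHw] k; first by rewrite /word_eval !big_nil !perm1.
rewrite /word_widen /= /word_eval !big_cons !permM -/(word_widen h w).
rewrite -!/(word_eval _ _) -IHw /= !tpermV !if_same; congr (_ _).
have -> : strand_lo (widen_ord (leq_pred2 h) i) = widen_ord h (strand_lo i).
  exact: val_inj.
have -> : strand_hi (widen_ord (leq_pred2 h) i) = widen_ord h (strand_hi i).
  exact: val_inj.
have winj : injective (widen_ord h).
  by move=> a c /(congr1 val) /= ac; apply: val_inj.
by rewrite !permE /= !(inj_eq winj) -!(fun_if (widen_ord h)).
Qed.

Lemma braid_perm_incl_out n m (h : n <= m) (x : braid n) (k : 'I_m) :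
  n <= k -> braid_perm (braid_incl h x) k = k.
Proof.
move=> nk; elim/pres_classW: x => w; rewrite braid_inclE braid_perm_class.
elim: w => [|[i b] w IHw]; first by rewrite /word_eval big_nil perm1.
rewrite /word_widen /= /word_eval big_cons permM -/(word_widen h w).
rewrite -/(word_eval _ _) /= tpermV if_same tpermD // -val_eqE /= ltn_eqF //.
  exact: leq_trans (strand_lo_subproof i) nk.
exact: leq_trans (strand_hi_subproof i) nk.
Qed.

Lemma pure_incl n m (h : n <= m) (x : braid n) :
  x \in @pure n -> braid_incl h x \in @pure m.
Proof.
rewrite !inE => /eqP px; apply/eqP/permP => k; rewrite perm1.
have [kn|nk] := ltnP k n; last exact: braid_perm_incl_out.
have -> : k = widen_ord h (Ordinal kn) by apply: val_inj.
by rewrite braid_perm_incl px perm1.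
Qed.

Lemma PinfJ (x y : Binf) : x \in Pinf -> x ^ y \in Pinf.
Proof.
move=> /asboolP[n [x' [px ->]]]; elim/dl_inW: y => m y.
apply/asboolP; exists (maxn n m).
pose u : braid (maxn n m) := braid_incl (leq_maxl n m) x'.
pose v : braid (maxn n m) := braid_incl (leq_maxr n m) y.
exists (u ^ v); split.
  have := pure_incl (leq_maxl n m) px; rewrite !inE -/u => /eqP pu.
  by rewrite /conjg !braid_permM pu mul1g -braid_permM mulVg braid_perm1.
have -> : braid_Binf x' = braid_Binf u.
  exact/esym/(@dl_in_map braid_system).
have -> : dl_in y = braid_Binf v.
  exact/esym/(@dl_in_map braid_system).
by rewrite /conjg /braid_Binf !dl_inM dl_inV.
Qed.

Definition comm_Pinf : normalSub Binf :=
  NormalSub (comm_sub_closed Pinf) (comm_subJ PinfJ).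

(** B_oo / [P_oo, P_oo] *)
Definition Binf_quot : groupType := quotg comm_Pinf.

Definition iso_to_sub (G Q : groupType) (H : {pred Q}) : Prop :=
  exists f : {multiplicative G -> Q},
    injective f /\ forall y, y \in H <-> exists x, f x = y.

Definition has_order (G : groupType) (x : G) (n : nat) : Prop :=
  [/\ 0 < n, x ^+ n = 1 & forall m, 0 < m -> x ^+ m = 1 -> n <= m].

(* Main.v *)
(** Counting the signed crossings of each pair of strands, together with the
    permutation, gives a homomorphism from B_oo to the semidirect product of
    Z^pairs by the finitary symmetric group. Its kernel is [P_oo, P_oo]: P_oo is
    the normal closure of sigma_0^2, and modulo [P_oo, P_oo] a conjugate of
    sigma_0^2 depends only on the pair of strands that it links. Its image
    consists of the (v, s) such that v_ab is odd exactly when s inverts the pair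
    {a, b}.

    An element of order 2 in the image would exchange some strands a and b, and
    would satisfy 2 v_ab = 0 with v_ab odd. A group G of odd order acts on its
    pairs of elements without reversing any pair, so the pairs can be oriented
    G-equivariantly; if c_ab in {0, 1} records whether this orientation of {a, b}
    disagrees with the standard one, then g |-> (g.c - c, g) embeds G in the
    image. *)

Require Import Defs.
From HB Require Import structures.
From mathcomp Require Import all_boot fingroup.
From mathcomp Require Import perm boolp generic_quotient ssralg ssrint zify.

Set Implicit Arguments.
Unset Strict Implicit.
Unset Printing Implicit Defensive.

Local Open Scope group_scope.

(** * Permutations and crossing numbers of braid words *)

Definition swapn (i a : nat) : nat :=
  if a == i then i.+1 else if a == i.+1 then i else a.

Definition crossing (i a b : nat) : bool :=
  ((a == i) && (b == i.+1)) || ((a == i.+1) && (b == i)).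

Definition wperm (w : word nat) (a : nat) : nat :=
  foldl (fun a l => swapn l.1 a) a w.

(** For a pure braid this is twice the usual linking number of the strands starting at [a] and [b].
    It is not halved, so that its parity makes sense for every braid. *)
Fixpoint wlink (w : word nat) (a b : nat) : int :=
  if w is l :: w' then
    ((if l.2 then - (crossing l.1 a b)%:Z else (crossing l.1 a b)%:Z)
     + wlink w' (swapn l.1 a) (swapn l.1 b))%R
  else 0%R.

Lemma swapn_cases i a :
  a = i /\ swapn i a = i.+1 \/ a = i.+1 /\ swapn i a = i \/
  a <> i /\ a <> i.+1 /\ swapn i a = a.
Proof. by rewrite /swapn; do ![case: eqP => ?]; lia. Qed.

(** The guard makes innermost applications of [swapn] be replaced first, so that each one becomes a
    variable with linear case constraints. *)
Ltac swapn_lia :=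
  rewrite /crossing;
  repeat match goal with |- context [swapn ?i ?a] =>
    lazymatch a with
    | context [swapn] => fail
    | _ => move: (swapn_cases i a); move: (swapn i a) => ? ?
    end
  end; lia.

Lemma swapnK i : involutive (swapn i).
Proof. by move=> a; swapn_lia. Qed.

Lemma swapn_comm i j a : i.+1 < j ->
  swapn j (swapn i a) = swapn i (swapn j a).
Proof. by move=> ij; swapn_lia. Qed.

Lemma swapn_braid i a : swapn i (swapn i.+1 (swapn i a)) =
  swapn i.+1 (swapn i (swapn i.+1 a)).
Proof. by swapn_lia. Qed.

Lemma crossing_swapn i a b : crossing i (swapn i a) (swapn i b) = crossing i a b.
Proof. by swapn_lia. Qed.

Lemma crossing_comm i j a b : i.+1 < j ->
  crossing j (swapn i a) (swapn i b) = crossing j a b.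
Proof. by move=> ij; swapn_lia. Qed.

Lemma crossing_commr i j a b : i.+1 < j ->
  crossing i (swapn j a) (swapn j b) = crossing i a b.
Proof. by move=> ij; swapn_lia. Qed.

(** The two sides of the braid relation cross the same three pairs of strands, in opposite orders.
    This matches the middle crossings; [crossing_braid] and [crossing_braid'] match the outer
    ones. *)
Lemma crossing_conj i a b :
  crossing i.+1 (swapn i a) (swapn i b) =
  crossing i (swapn i.+1 a) (swapn i.+1 b).
Proof. by swapn_lia. Qed.

Lemma crossing_braid i a b :
  crossing i (swapn i.+1 (swapn i a)) (swapn i.+1 (swapn i b)) =
  crossing i.+1 a b.
Proof. by rewrite -crossing_conj !swapnK. Qed.

Lemma crossing_braid' i a b :
  crossing i.+1 (swapn i (swapn i.+1 a)) (swapn i (swapn i.+1 b)) =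
  crossing i a b.
Proof. by rewrite crossing_conj !swapnK. Qed.

Lemma wperm_cat u v a : wperm (u ++ v) a = wperm v (wperm u a).
Proof. exact: foldl_cat. Qed.

Lemma wlink_cat u v a b :
  wlink (u ++ v) a b = (wlink u a b + wlink v (wperm u a) (wperm u b))%R.
Proof.
elim: u a b => [|l u IHu] a b /=; first by rewrite GRing.add0r.
by rewrite IHu GRing.addrA.
Qed.

Definition forget_word n (w : word 'I_n) : word nat :=
  [seq (val l.1, l.2) | l <- w].

Lemma pres_eq_wperm_wlink n (u v : word 'I_n.-1) : pres_eq (@braid_rel n) u v ->
  wperm (forget_word u) =1 wperm (forget_word v) /\
  wlink (forget_word u) =2 wlink (forget_word v).
Proof.
elim=> {u v} [u v|x b|u u' v v' _ [pu lu] _ [pv lv]|//|u v _ [p l]|v u w _ [p l] _ [p' l']].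
- case=> i j ij; split=> a; rewrite /wperm /=.
  + exact: swapn_comm.
  + by move=> b; rewrite crossing_comm // crossing_commr //; lia.
  + by rewrite ij swapn_braid.
  + by move=> b; rewrite ij crossing_braid crossing_braid' crossing_conj; lia.
- split=> a; rewrite /wperm /=; first exact: swapnK.
  by move=> c; rewrite crossing_swapn; case: b => /=; lia.
- rewrite /forget_word !map_cat; split=> a.
    by rewrite !wperm_cat pu pv.
  by move=> b; rewrite !wlink_cat !pu lu lv.
- by split=> a; rewrite ?p // => b; rewrite l.
- by split=> a; rewrite ?p ?p' // => b; rewrite l l'.
Qed.

(** * Permutations and crossing numbers on [Binf] *)

Definition Binf_word (x : Binf) : word nat :=
  forget_word (repr (tagged (repr x) : braid _)).

Definition bperm (x : Binf) : nat -> nat := wperm (Binf_word x).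
Definition link (x : Binf) : nat -> nat -> int := wlink (Binf_word x).

Lemma forget_word_widen n m (h : n <= m) w :
  forget_word (word_widen h w) = forget_word w.
Proof. by rewrite /forget_word /word_widen -map_comp. Qed.

(** Independence of the chosen representative: two braids with the same limit agree on some larger
    number of strands, and widening does not change the underlying word over [nat]. *)
Lemma bperm_link_class n (w : word 'I_n.-1) :
  let x := braid_Binf (pres_class (@braid_rel n) w) in
  bperm x =1 wperm (forget_word w) /\ link x =2 wlink (forget_word w).
Proof.
rewrite /bperm /link /Binf_word /braid_Binf /=.
set x : Binf := dl_in _.
have: dl_in (tagged (repr x)) = x by exact: dl_in_repr.
case: (repr x) => m /= y /dl_inP[k [hm [hn]]].
have {1}-> : y = pres_class (@braid_rel m) (repr (y : braid m)).
  by rewrite /pres_class reprK.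
rewrite /= !braid_inclE => /pres_classP /pres_eq_wperm_wlink.
by rewrite !forget_word_widen.
Qed.

Definition sig (i : nat) : Binf := braid_Binf (@sigma i.+2 ord_max).

Lemma braid_Binf_sigma n (i : 'I_n.-1) : braid_Binf (sigma i) = sig i.
Proof.
apply/dl_inP; exists (maxn n i.+2), (leq_maxl _ _), (leq_maxr _ _).
by rewrite /= !braid_incl_sigma; congr sigma; apply: val_inj.
Qed.

Lemma braid_BinfM n : {morph @braid_Binf n : x y / x * y}.
Proof. exact: (@dl_inM braid_system). Qed.

Definition ev : word nat -> Binf := word_eval sig.

Lemma ev_cat u v : ev (u ++ v) = ev u * ev v.
Proof. exact: word_eval_cat. Qed.

Lemma ev1 i b : ev [:: (i, b)] = if b then (sig i)^-1 else sig i.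
Proof. by rewrite /ev /word_eval big_seq1. Qed.

Lemma ev_forget n (w : word 'I_n.-1) :
  ev (forget_word w) = braid_Binf (pres_class (@braid_rel n) w).
Proof.
elim: w => [|[i b] w IHw].
  by rewrite /ev /word_eval big_nil; apply/esym/(@dl_in1 braid_system).
rewrite -(cat1s _ w) pres_classM braid_BinfM -IHw /forget_word map_cat ev_cat.
congr (_ * _); rewrite ev1 -braid_Binf_sigma; case: b => //=.
rewrite -[_^-1](@dl_inV braid_system) -/(braid_Binf _) /braid_Binf.
by rewrite [in LHS]/sigma /pres_gen -pres_class_inv.
Qed.

Lemma Binf_evP (x : Binf) : exists w, x = ev w.
Proof.
elim/dl_inW: x => n x; elim/pres_classW: x => w.
by exists (forget_word w); rewrite ev_forget.
Qed.

Lemma word_forgetP (w : word nat) : exists n (u : word 'I_n.-1), w = forget_word u.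
Proof.
(* The letter [i] involves the strands [i] and [i.+1], hence needs [i.+2] strands. *)
exists (\max_(l <- w) l.1.+2).
have: all (fun l => l.1 < (\max_(l <- w) l.1.+2).-1) w.
  apply/allP => l lw; rewrite -ltnS.
  have := leq_bigmax_seq (F := fun l : nat * bool => l.1.+2) l lw isT.
  by case: (\max_(_ <- _) _).
move: (\max_(l <- w) _) => n; elim: w => [|[i b] w IHw] /=; first by exists [::].
by move=> /andP[hi /IHw[u ->]]; exists ((Ordinal hi, b) :: u).
Qed.

Lemma bperm_ev w : bperm (ev w) =1 wperm w.
Proof.
have [n [u ->]] := word_forgetP w; rewrite ev_forget.
by have [] := bperm_link_class u.
Qed.

Lemma link_ev w : link (ev w) =2 wlink w.
Proof.
have [n [u ->]] := word_forgetP w; rewrite ev_forget.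
by have [] := bperm_link_class u.
Qed.

Lemma sig_comm i j : i.+1 < j -> sig i * sig j = sig j * sig i.
Proof.
move=> ij; have hi : i < (j.+2).-1 by rewrite /=; lia.
have -> : sig i = braid_Binf (@sigma j.+2 (Ordinal hi)) by rewrite braid_Binf_sigma.
by rewrite -!braid_BinfM sigma_comm.
Qed.

Lemma sig_braid i : sig i * sig i.+1 * sig i = sig i.+1 * sig i * sig i.+1.
Proof.
have hi : i < (i.+3).-1 by rewrite /=; lia.
have -> : sig i = braid_Binf (@sigma i.+3 (Ordinal hi)) by rewrite braid_Binf_sigma.
by rewrite -!braid_BinfM sigma_braid.
Qed.

Lemma bpermM x y a : bperm (x * y) a = bperm y (bperm x a).
Proof.
by have [[u ->] [v ->]] := (Binf_evP x, Binf_evP y); rewrite -ev_cat !bperm_ev wperm_cat.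
Qed.

Lemma linkM x y a b :
  link (x * y) a b = (link x a b + link y (bperm x a) (bperm x b))%R.
Proof.
have [[u ->] [v ->]] := (Binf_evP x, Binf_evP y).
by rewrite -ev_cat !bperm_ev !link_ev wlink_cat.
Qed.

Lemma ev_nil : ev [::] = 1. Proof. by rewrite /ev /word_eval big_nil. Qed.

Lemma bperm1 a : bperm 1 a = a. Proof. by rewrite -ev_nil bperm_ev. Qed.
Lemma link1 a b : link 1 a b = 0%R. Proof. by rewrite -ev_nil link_ev. Qed.

Lemma bpermK x : cancel (bperm x) (bperm x^-1).
Proof. by move=> a; rewrite -bpermM mulgV bperm1. Qed.

Lemma bpermKV x : cancel (bperm x^-1) (bperm x).
Proof. by move=> a; rewrite -bpermM mulVg bperm1. Qed.

Lemma linkV x a b : link x^-1 a b = (- link x (bperm x^-1%g a) (bperm x^-1%g b))%R.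
Proof. by have := linkM x^-1 x a b; rewrite mulVg link1; lia. Qed.

Lemma bperm_sig i : bperm (sig i) =1 swapn i.
Proof. by move=> a; rewrite -(ev1 i false) bperm_ev. Qed.

Lemma link_sig i a b : link (sig i) a b = (crossing i a b)%:Z%R.
Proof. by rewrite -(ev1 i false) link_ev /= GRing.addr0. Qed.

Lemma linkC x a b : link x a b = link x b a.
Proof.
have [w ->] := Binf_evP x; rewrite !link_ev.
elim: w a b => //= l w IHw a b; rewrite IHw.
by have -> : crossing l.1 a b = crossing l.1 b a by rewrite /crossing; lia.
Qed.

Lemma linkaa x a : link x a a = 0%R.
Proof.
have [w ->] := Binf_evP x; rewrite !link_ev.
elim: w a => //= l w IHw a; rewrite IHw.
have -> : crossing l.1 a a = false by rewrite /crossing; lia.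
by case: (l.2).
Qed.

(** Each crossing of the two strands changes their number by one and reverses their relative
    order. *)
Lemma link_parity x a b : a != b ->
  exists k : int, link x a b = (k *+ 2 + ((a < b) (+) (bperm x a < bperm x b))%:Z)%R.
Proof.
have [w ->] := Binf_evP x; rewrite !link_ev !bperm_ev.
elim: w a b => [|[i e] w IHw] a b ab; first by exists 0%R; rewrite addbb.
rewrite /wperm /= -!/(wperm w _).
have /IHw[k ->] : swapn i a != swapn i b by rewrite (can_eq (swapnK i)).
move: (wperm w _ < _) => c;
have -> : (a < b) = (swapn i a < swapn i b) (+) crossing i a b by swapn_lia.
move: (swapn i a < _) (crossing i a b) => d f.
case: e; [exists (k - (f && ~~ (d (+) c))%:Z)%R | exists (k + (f && (d (+) c))%:Z)%R];
  by case: c; case: d; case: f => /=; lia.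
Qed.

Lemma link_fin x : exists N, forall a b, N <= b -> link x a b = 0%R.
Proof.
have [w ->] := Binf_evP x.
exists (\max_(l <- w) l.1.+2) => a b; rewrite link_ev => Nb.
have: all (fun l => l.1.+1 < b) w.
  apply/allP => l lw; apply: leq_trans Nb.
  exact: (leq_bigmax_seq (F := fun l : nat * bool => l.1.+2) l lw isT).
elim: w a {Nb} => //= l w IHw a /andP[lb wb].
have -> : swapn l.1 b = b by swapn_lia.
have -> : crossing l.1 a b = false by rewrite /crossing; lia.
by rewrite IHw //; case: (l.2).
Qed.

(** * Pure braids and their crossing numbers *)

Lemma braid_perm_wperm n (w : word 'I_n.-1) (k : 'I_n) :
  val (braid_perm (pres_class (@braid_rel n) w) k) = wperm (forget_word w) k.
Proof.
rewrite braid_perm_class; elim: w k => [|[i b] w IHw] k.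
  by rewrite /word_eval big_nil perm1.
rewrite /word_eval big_cons permM -/(word_eval _ _) IHw /wperm /= tpermV if_same.
congr foldl; rewrite permE /= /swapn -!val_eqE /=.
by do !case: eqP.
Qed.

Lemma wperm_out (w : word nat) m n a : all (fun l => m <= l.1 < n) w ->
  (a < m) || (n < a) -> wperm w a = a.
Proof.
move=> + an; elim: w => //= l w IHw /andP[ln /IHw e].
rewrite /wperm /=; have -> : swapn l.1 a = a by swapn_lia.
exact: e.
Qed.

Lemma PinfP x : reflect (bperm x =1 id) (x \in Pinf).
Proof.
apply: (iffP (asboolP _)) => [[n [y [+ ->]]]|].
  elim/pres_classW: y => w; rewrite inE => /eqP py a.
  have [-> _] := bperm_link_class w; have [an|na] := ltnP a n.
    by rewrite -[a]/(val (Ordinal an)) -braid_perm_wperm py perm1.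
  (* With no strands there are no letters; with [n.+1] strands the letters are below [n] and only
     strands up to [n] move. *)
  case: n w na {py} => [[|[[]]]//|n] w na; apply: (@wperm_out _ 0 n); last by lia.
  by rewrite all_map; apply/allP => -[i b] _ /=; case: i.
elim/dl_inW: x => n x; elim/pres_classW: x => w.
have [px _ id_w] := bperm_link_class w.
exists n, (pres_class _ w); split=> //; rewrite inE.
by apply/eqP/permP => k; apply: val_inj; rewrite braid_perm_wperm -px id_w perm1.
Qed.

Lemma PinfM x y : x \in Pinf -> y \in Pinf -> x * y \in Pinf.
Proof. by move=> /PinfP px /PinfP py; apply/PinfP => a; rewrite bpermM px py. Qed.

Lemma PinfV x : x \in Pinf -> x^-1 \in Pinf.
Proof. by move=> /PinfP px; apply/PinfP => a; rewrite -{1}[a]px bpermK. Qed.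

Lemma link_PinfM x y a b : x \in Pinf ->
  link (x * y) a b = (link x a b + link y a b)%R.
Proof. by move=> /PinfP px; rewrite linkM !px. Qed.

Lemma link_PinfV x a b : x \in Pinf -> link x^-1 a b = (- link x a b)%R.
Proof. by move=> /PinfV/PinfP px; rewrite linkV !px. Qed.

Lemma link_conj x c a b : x \in Pinf ->
  link (x ^ c) a b = link x (bperm c^-1 a) (bperm c^-1 b).
Proof. by move=> Px; rewrite /conjg !linkM linkV !(PinfP _ Px); lia. Qed.

(** On pure braids each crossing number is additive with values in an abelian group, so it kills
    commutators. *)
Lemma comm_Pinf_link x : x \in (comm_Pinf : {pred Binf}) ->
  x \in Pinf /\ forall a b, link x a b = 0%R.
Proof.
move=> /asboolP/(_ [pred y | `[< y \in Pinf /\ forall a b, link y a b = 0%R >]]).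
move=> h; apply/asboolP; apply: h.
  split; first by apply/asboolP; split=> [|a b]; [apply/PinfP => a; rewrite bperm1 | rewrite link1].
  move=> y z /asboolP[Py ly] /asboolP[Pz lz]; apply/asboolP.
  split=> [|a b]; first by rewrite PinfM ?PinfV.
  by rewrite link_PinfM // link_PinfV // ly lz.
move=> z /asboolP[y [y' [Py Py' ->]]]; apply/asboolP.
have PR: y ^ y' \in Pinf by apply: PinfJ.
split=> [|a b]; first by rewrite /commg PinfM ?PinfV.
rewrite /commg link_PinfM ?PinfV // link_PinfV // link_conj //.
by rewrite !(PinfP _ (PinfV Py')); lia.
Qed.

(** * Classes modulo the commutator subgroup of the pure braids *)

Definition qcls (x : Binf) : Binf_quot := qg_class comm_Pinf x.

Lemma qclsM : {morph qcls : x y / x * y}.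
Proof. exact: qg_classM. Qed.

Lemma qcls1 : qcls 1 = 1.
Proof. by []. Qed.

Lemma qclsV x : qcls x^-1 = (qcls x)^-1.
Proof. by apply: (mulgI (qcls x)); rewrite -qclsM !mulgV qcls1. Qed.

Lemma qclsJ x y : qcls (x ^ y) = qcls x ^ qcls y.
Proof. by rewrite /conjg !qclsM qclsV. Qed.

Lemma qcls_comm x y : x \in Pinf -> y \in Pinf -> commute (qcls x) (qcls y).
Proof.
move=> Px Py; rewrite /commute -!qclsM; apply/esym/qg_classP.
apply/asboolP => H _; apply; apply/asboolP; exists x, y; split=> //.
by rewrite /commg /conjg invgM !mulgA.
Qed.

(** * Braids supported on a segment of strands *)

(** The letters stop before [n], but the strand [n] itself may move. *)
Definition seg (m n : nat) (x : Binf) : Prop :=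
  exists2 w, all (fun l => m <= l.1 < n) w & x = ev w.

Lemma seg1 m n : seg m n 1.
Proof. by exists [::]; rewrite ?ev_nil. Qed.

Lemma segM m n x y : seg m n x -> seg m n y -> seg m n (x * y).
Proof.
by move=> [u su ->] [v sv ->]; exists (u ++ v); rewrite ?all_cat ?su ?ev_cat.
Qed.

Lemma seg_sig m n i : m <= i < n -> seg m n (sig i).
Proof. by move=> mi; exists [:: (i, false)]; rewrite ?ev1 //= mi. Qed.

Lemma seg_mono m n m' n' x : m' <= m -> n <= n' -> seg m n x -> seg m' n' x.
Proof. by move=> mm nn [w sw ->]; exists w => //; apply: sub_all sw => l /=; lia. Qed.

Lemma seg_out m n x a : seg m n x -> (a < m) || (n < a) -> bperm x a = a.
Proof. by move=> [w sw ->] /(wperm_out sw); rewrite bperm_ev. Qed.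

Lemma seg_comm m n x i : seg m n x -> (i.+1 < m) || (n < i) -> commute (sig i) x.
Proof.
move=> [w + ->] io; elim: w => [|[j b] w IHw] /=; first by rewrite ev_nil => _; apply: commute1.
move=> /andP[jn /IHw]; rewrite -(cat1s _ w) ev_cat; apply: commuteM.
have c : commute (sig i) (sig j).
  have [ij|ji] := ltnP i.+1 j; first exact: sig_comm.
  by apply/esym/sig_comm; lia.
by rewrite ev1; case: b => //; apply: commuteV.
Qed.

(** Coset representatives as for symmetric groups: the descending product from [sig (j + k - 1)] to
    [sig j], which carries the strand [j + k] down to [j]. *)
Fixpoint desc (j k : nat) : Binf := if k is k'.+1 then sig (j + k') * desc j k' else 1.

Lemma descSr j k : desc j k.+1 = desc j.+1 k * sig j.
Proof.
elim: k => [|k IHk]; first by rewrite /= addn0 mulg1 mul1g.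
by rewrite -[LHS]/(sig (j + k.+1) * desc j k.+1) IHk mulgA /= addSnnS.
Qed.

Lemma seg_desc m n j k : m <= j -> j + k <= n -> seg m n (desc j k).
Proof.
move=> mj; elim: k => [|k IHk] /= jn; first exact: seg1.
by apply: segM; [apply: seg_sig; lia | apply: IHk; lia].
Qed.

Lemma bperm_desc j k : bperm (desc j k) (j + k) = j.
Proof.
elim: k => [|k IHk] /=; first by rewrite bperm1 addn0.
rewrite bpermM bperm_sig -[RHS]IHk; congr bperm; swapn_lia.
Qed.

(** The letter [sig i] commutes with every letter of [desc] except those around [i], where the braid
    relation lowers its index. *)
Lemma desc_sig j k i : j < i < j + k -> desc j k * sig i = sig i.-1 * desc j k.
Proof.
elim: k => [|k IHk] ji /=; first by lia.
have [ik|ik] := eqVneq i (j + k); last first.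
  rewrite -mulgA IHk ?mulgA; last by lia.
  by congr (_ * _); apply/esym/sig_comm; lia.
case: k ik {IHk} ji => [|k] ik ji; first by lia.
have c : commute (sig i) (desc j k) by apply: (@seg_comm j (j + k)); [exact: seg_desc | lia].
have -> : i.-1 = j + k by lia.
rewrite -ik /= -!mulgA -c !mulgA.
have -> : i = (j + k).+1 by lia.
by rewrite sig_braid.
Qed.

Lemma sig_conj i : exists c, sig i = sig 0 ^ c.
Proof.
elim: i => [|i [c IHi]]; first by exists 1; rewrite conjg1.
exists (c * (sig i.+1 * sig i)); rewrite conjgM -IHi.
by rewrite /conjg [sig i * _]mulgA sig_braid mulKg.
Qed.

(** * Pure braids as the normal closure of sigma_0^2 *)

Definition sq (c : Binf) : Binf := (sig 0 * sig 0) ^ c.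

Definition sq_gens : {pred Binf} := [pred z | `[< exists c, z = sq c >]].

Lemma gen_sub_closed (G : groupType) (A : {pred G}) : group_closed (gen_sub A).
Proof.
split; first by apply/asboolP=> H [].
move=> x y /asboolP Ax /asboolP Ay; apply/asboolP=> H cH sAH.
by have [_] := cH; apply; [apply: Ax | apply: Ay].
Qed.

Lemma gen_subJ (G : groupType) (A : {pred G}) :
  (forall x y, x \in A -> x ^ y \in A) ->
  forall x y, x \in gen_sub A -> x ^ y \in gen_sub A.
Proof.
move=> nA x y /asboolP Ax; apply/asboolP=> H [H1 HF] sAH.
suff: x \in [pred z | z ^ y \in H] by [].
apply: Ax => [|z Az]; last by rewrite inE; apply/sAH/nA.
by split=> [|u v]; rewrite !inE ?conj1g // conjMg conjVg; apply: HF.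
Qed.

Lemma sq_gensJ x y : x \in sq_gens -> x ^ y \in sq_gens.
Proof. by move=> /asboolP[c ->]; apply/asboolP; exists (c * y); rewrite /sq conjgM. Qed.

Definition sq_sub : normalSub Binf :=
  NormalSub (@gen_sub_closed Binf sq_gens) (gen_subJ sq_gensJ).

Local Notation "x \inD" := (x \in (sq_sub : {pred Binf})) (at level 70).

Lemma sq_in_sub c : sq c \inD.
Proof. by apply/asboolP=> H _; apply; apply/asboolP; exists c. Qed.

Lemma sig2_in_sub i : sig i * sig i \inD.
Proof. by have [c ->] := sig_conj i; rewrite -conjMg; apply: sq_in_sub. Qed.

Lemma sq_Pinf c : sq c \in Pinf.
Proof. by apply/PinfJ/PinfP => a; rewrite bpermM !bperm_sig swapnK. Qed.

Lemma sq_sub_Pinf x : x \inD -> x \in Pinf.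
Proof.
move=> /asboolP; apply; last by move=> _ /asboolP[c ->]; apply: sq_Pinf.
by split=> [|u v Pu Pv]; [apply/PinfP => a; rewrite bperm1 | rewrite PinfM ?PinfV].
Qed.

(** Right multiplication by [sig i] permutes the cosets. If [i.+1 < j] or [j < i], the letter passes
    to the left and is absorbed in [y]; if [i.+1 = j] it lengthens [desc]; if [i = j] it shortens
    [desc], up to a conjugate of a square. *)
Lemma coset_step n y j i : seg 0 n y -> j <= n.+1 -> i <= n ->
  exists d y' j', [/\ d \inD, seg 0 n y', j' <= n.+1 &
    y * desc j (n.+1 - j) * sig i = d * y' * desc j' (n.+1 - j')].
Proof.
move=> sy jn i_n; have D1 := nsub1 sq_sub.
have [ij|ji|ij] := ltngtP i.+1 j; last subst j.
- exists 1, (y * sig i), j; split=> //; first by apply: segM => //; apply: seg_sig; lia.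
  rewrite mul1g -!mulgA; congr (_ * _); apply/esym.
  by apply: (@seg_comm j n.+1); [apply: seg_desc; lia | lia].
- have {ji}[ji|ij] : j < i \/ i = j by lia.
    exists 1, (y * sig i.-1), j; split=> //.
      by apply: segM => //; apply: seg_sig; lia.
    by rewrite mul1g -!mulgA desc_sig //; lia.
  (* [desc] ends in [sig j], so the product is [u] times the square of [sig j]; conjugation by
     [u^-1] moves this square to the left. *)
  subst i; pose u := y * desc j.+1 (n - j).
  exists ((sig j * sig j) ^ u^-1), y, j.+1.
  split=> //; first exact/nsubJ/sig2_in_sub.
  rewrite subSS subSn // descSr -[RHS]mulgA -/u /conjg invgK (mulgA u) mulgKV.
  by rewrite /u !mulgA.
- exists 1, y, i; split=> //; first by lia.
  by rewrite mul1g -mulgA -descSr; congr (_ * desc _ _); lia.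
Qed.

Lemma coset_form n x : seg 0 n.+1 x ->
  exists d y j, [/\ d \inD, seg 0 n y, j <= n.+1 & x = d * y * desc j (n.+1 - j)].
Proof.
move=> [w + ->]; elim/last_ind: w => [|w [i b] IHw].
  exists 1, 1, n.+1; rewrite nsub1 subnn ev_nil !mulg1; split=> //; exact: seg1.
rewrite all_rcons -cats1 => /andP[/= i_n /IHw[d [y [j [Dd sy jn e]]]]].
have [d' [y' [j' [Dd' sy' jn' e']]]] := coset_step sy jn i_n.
rewrite ev_cat ev1 e; case: b; last first.
  exists (d * d'), y', j'; split=> //; first exact: (@nsubM _ sq_sub).
  by rewrite -(mulgA d) -(mulgA d) e' !mulgA.
set z := y' * desc j' (n.+1 - j').
exists (d * (d' * ((sig i * sig i)^-1 ^ z^-1))), y', j'; split=> //.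
  by apply: (@nsubM _ sq_sub) => //; apply: (@nsubM _ sq_sub) => //; apply/nsubJ/nsubV/sig2_in_sub.
(* An inverse letter equals the letter itself up to a square, which reduces to the positive case. *)
have -> : (sig i)^-1 = sig i * (sig i * sig i)^-1 by rewrite invgM mulgA mulgV mul1g.
transitivity (d * (y * desc j (n.+1 - j) * sig i * (sig i * sig i)^-1)).
  by rewrite !mulgA.
rewrite e' -[RHS]mulgA -/z -(mulgA d' y') -/z -!(mulgA d) -!(mulgA d').
by congr (_ * (_ * _)); rewrite /conjg invgK (mulgA z) mulgKV.
Qed.

Lemma seg_ex x : exists n, seg 0 n x.
Proof.
have [w ->] := Binf_evP x; have [n [u ->]] := word_forgetP w.
exists n.-1, (forget_word u) => //.
by rewrite all_map; apply/allP => -[i b] _ /=; case: i.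
Qed.

(* This amounts to the Coxeter presentation of the symmetric groups. *)
Lemma Pinf_sq_sub x : x \in Pinf -> x \inD.
Proof.
have [n] := seg_ex x.
elim: n x => [|n IHn] x.
  by move=> [[|l w] //= _ ->] _; rewrite ev_nil; apply: (nsub1 sq_sub).
move=> /coset_form[d [y [j [Dd sy jn ->]]]].
rewrite -mulgA => Px; apply: (@nsubM _ sq_sub) => //.
have {Px} Py : y * desc j (n.+1 - j) \in Pinf.
  by have := PinfM (PinfV (sq_sub_Pinf Dd)) Px; rewrite mulKg.
(* The factor [y] fixes the strand [n.+1], which [desc] then carries to [j]; purity forces
   [j = n.+1]. *)
have ej : j = n.+1.
  have := PinfP _ Py n.+1; rewrite bpermM (seg_out sy) ?leqnn ?orbT //.
  by have := bperm_desc j (n.+1 - j); rewrite subnKC // => ->.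
by move: Py; rewrite ej subnn mulg1; apply: IHn.
Qed.

(** * Conjugates of sigma_0^2 modulo commutators *)

Lemma bperm_surj m k (f : nat -> nat) : injective f ->
  (forall a, (a < m) || (m + k <= a) -> f a = a) ->
  exists2 x, seg m (m + k) x & bperm x =1 f.
Proof.
elim: k f => [|k IHk] f fI fout.
  exists 1; first exact: seg1.
  by move=> a; rewrite bperm1 fout //; lia.
set n := m + k; set j := f n; have jn : m <= j <= n.
  have fj : (j < m) || (m + k.+1 <= j) -> j = n by move=> /fout /fI.
  by rewrite /n in fj *; lia.
(* The braid [t] sends [n] to [f n], so [f] followed by the inverse of [t] fixes [n] and the
   induction applies. *)
set t := desc j (n - j).
have st : seg m (m + k) t by apply: seg_desc; lia.
have tn : bperm t n = j by have := bperm_desc j (n - j); rewrite subnKC //; lia.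
have [||x sx ex] := IHk (bperm t^-1 \o f).
- exact: inj_comp (can_inj (bpermKV t)) fI.
- move=> a ao /=; have [->|an] := eqVneq a n; first by rewrite -/j -tn bpermK.
  rewrite fout; last by rewrite /n in an *; lia.
  rewrite -{1}[a](seg_out st) ?bpermK //; rewrite /n in an *; lia.
exists (x * t); first by apply: (@seg_mono m (m + k)) => //; [lia | apply: segM].
by move=> a; rewrite bpermM ex bpermKV.
Qed.

(* If z fixes strands 0 and 1, it agrees up to a pure braid with a braid on the
   strands from 2 on, and the latter commutes with sig 0. *)
Lemma qcls_sq_eq c c' : bperm c 0 = bperm c' 0 -> bperm c 1%N = bperm c' 1%N ->
  qcls (sq c) = qcls (sq c').
Proof.
move=> e0 e1; pose z := c * c'^-1.
have z0 : bperm z 0 = 0 by rewrite bpermM e0 bpermK.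
have z1 : bperm z 1%N = 1%N by rewrite bpermM e1 bpermK.
have [n sz] := seg_ex z.
have [|a ao|z' sz' ez] := @bperm_surj 2 n (bperm z); first exact: can_inj (bpermK z).
  by case: a ao => [|[|a]] // an; apply: (seg_out sz); lia.
have [p Pp ->] : exists2 p, p \in Pinf & c = p * z' * c'.
  exists (z * z'^-1); last by rewrite !mulgKV.
  by apply/PinfP => a; rewrite bpermM -ez bpermK.
have P2 : sig 0 * sig 0 \in Pinf by have := sq_Pinf 1; rewrite /sq conjg1.
have cz : commute (sig 0) z' by apply: (seg_comm sz').
rewrite /sq !conjgM [LHS]qclsJ [RHS]qclsJ; congr (_ ^ _).
have conj_comm (G : groupType) (x y : G) : commute x y -> x ^ y = x.
  by move=> xy; rewrite /conjg xy mulKg.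
rewrite qclsJ [X in X ^ _]qclsJ (conj_comm _ _ _ (qcls_comm P2 Pp)).
rewrite -qclsJ conj_comm //.
by apply/commute_sym/commuteM; apply: commute_sym.
Qed.

(** The unordered pair of strands that [sq c] links, stored in increasing order. *)
Definition sq_key (c : Binf) : nat * nat :=
  (minn (bperm c 0) (bperm c 1%N), maxn (bperm c 0) (bperm c 1%N)).

Lemma sq_key_lt c : (sq_key c).1 < (sq_key c).2.
Proof.
have : bperm c 0 != bperm c 1%N by rewrite (can_eq (bpermK c)).
by rewrite /=; lia.
Qed.

Lemma qcls_sq_key c c' : sq_key c = sq_key c' -> qcls (sq c) = qcls (sq c').
Proof.
move=> [emin emax].
have [[e0 e1]|[e0 e1]] : bperm c 0 = bperm c' 0 /\ bperm c 1%N = bperm c' 1%N \/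
    bperm c 0 = bperm c' 1%N /\ bperm c 1%N = bperm c' 0 by lia.
  exact: qcls_sq_eq.
(* Since [sig 0] commutes with its square, premultiplying [c] by it keeps the conjugate and
   exchanges the images of 0 and 1. *)
have -> : sq c = sq (sig 0 * c) by rewrite /sq conjgM; congr (_ ^ c); rewrite /conjg -mulgA mulKg.
by apply: qcls_sq_eq; rewrite bpermM bperm_sig.
Qed.

Lemma link_sq c a b : a < b ->
  link (sq c) a b = ((sq_key c == (a, b))%:Z *+ 2)%R.
Proof.
move=> ab; rewrite /sq link_conj; last by have := sq_Pinf 1; rewrite /sq conjg1.
rewrite linkM !bperm_sig !link_sig crossing_swapn GRing.mulr2n.
suff -> : crossing 0 (bperm c^-1 a) (bperm c^-1 b) = (sq_key c == (a, b)) by [].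
have e x k : (bperm c^-1 x == k) = (x == bperm c k).
  by rewrite -(can_eq (bpermK c)) bpermKV.
rewrite /crossing !e xpair_eqE; lia.
Qed.

(** * The kernel of the crossing numbers on pure braids *)

Lemma prodg_commute (G : groupType) (I : Type) (F : I -> G) x r :
  (forall i, commute x (F i)) -> commute x (\prod_(i <- r) F i).
Proof.
move=> cF; elim: r => [|i r IHr]; first by rewrite big_nil; apply: commute1.
by rewrite big_cons; apply: commuteM.
Qed.

Lemma perm_map_prodg (G : groupType) (I K : eqType) (F : I -> G) (key : I -> K) r r' :
  (forall i j, commute (F i) (F j)) -> (forall i j, key i = key j -> F i = F j) ->
  perm_eq (map key r) (map key r') -> \prod_(i <- r) F i = \prod_(i <- r') F i.
Proof.
move=> cF eF; elim: r r' => [|i r IHr] r' /= pr.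
  by have /eqP := perm_size pr; rewrite eq_sym size_map => /nilP ->.
have /mapP[j jr' ij] : key i \in map key r'.
  by rewrite -(perm_mem pr) mem_head.
have pj := perm_to_rem jr'; have cj r1 := prodg_commute r1 (cF j).
have /IHr e : perm_eq (map key r) (map key (rem j r')).
  by rewrite -(perm_cons (key i)) (perm_trans pr) // ij (perm_map key pj).
rewrite big_cons e (eF _ _ ij); case/splitPr: {pr pj e} jr' => r1 r2.
elim: r1 => [|k r1 IHr1] /=; first by rewrite eqxx big_cons.
case: eqP => [->|_]; rewrite !big_cons; last first.
  by rewrite -IHr1 !mulgA (cF j).
by rewrite !big_cat big_cons /= !mulgA (cj r1).
Qed.

Definition qprod (L : seq Binf) : Binf_quot := \prod_(c <- L) qcls (sq c).

Lemma qprod_commute L M : commute (qprod L) (qprod M).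
Proof.
apply: prodg_commute => c; apply/commute_sym; apply: prodg_commute => c'.
by apply: qcls_comm; apply: sq_Pinf.
Qed.

(** The property defines a subgroup containing all [sq c], which generate the pure braids. [L] lists
    the conjugates taken positively and [M] those taken inversely. *)
Lemma Pinf_decomp x : x \in Pinf -> exists L M,
  qcls x = qprod L * (qprod M)^-1 /\
  forall a b, a < b -> link x a b =
    ((count_mem (a, b) (map sq_key L))%:Z *+ 2 -
     (count_mem (a, b) (map sq_key M))%:Z *+ 2)%R.
Proof.
move=> Px; pose H : {pred Binf} := [pred y | `[< y \in Pinf /\ exists L M,
  qcls y = qprod L * (qprod M)^-1 /\ forall a b, a < b -> link y a b =
    ((count_mem (a, b) (map sq_key L))%:Z *+ 2 -
     (count_mem (a, b) (map sq_key M))%:Z *+ 2)%R >]].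
suff /asboolP[] : x \in H by [].
move/asboolP: (Pinf_sq_sub Px); apply; last first.
  move=> _ /asboolP[c ->]; apply/asboolP; split; first exact: sq_Pinf.
  exists [:: c], [::]; rewrite /qprod big_nil big_seq1 invg1 mulg1; split=> // a b ab.
  by rewrite link_sq //= addn0 GRing.mul0rn GRing.subr0.
split.
  apply/asboolP; split; first by apply/PinfP => a; rewrite bperm1.
  exists [::], [::]; rewrite /qprod big_nil invg1 mulg1; split=> // a b ab.
  by rewrite link1.
move=> y z /asboolP[Py [L [M [ey ly]]]] /asboolP[Pz [L' [M' [ez lz]]]]; apply/asboolP.
split; first by rewrite PinfM ?PinfV.
exists (L ++ M'), (M ++ L'); split=> [|a b ab].
  have qcat A B : qprod (A ++ B) = qprod A * qprod B by apply: big_cat.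
  rewrite qclsM qclsV ey ez !qcat !invgM invgK -!mulgA; congr (_ * _).
  rewrite [RHS]mulgA; apply: commuteM; last apply: commuteV.
    by apply/commute_sym/commuteV/qprod_commute.
  by apply/commute_sym/commuteV/qprod_commute.
rewrite link_PinfM // link_PinfV // ly // lz // !map_cat !count_cat; lia.
Qed.

Lemma Pinf_link0_qcls1 x : x \in Pinf -> (forall a b, a < b -> link x a b = 0%R) ->
  qcls x = 1.
Proof.
move=> /Pinf_decomp[L [M [-> lx]]] l0; apply/eqP; rewrite mulg_eq1 invgK; apply/eqP.
apply: (perm_map_prodg (key := sq_key)) => [c c'||].
- by apply: qcls_comm; apply: sq_Pinf.
- exact: qcls_sq_key.
(* Vanishing crossing numbers say that each pair is the key of equally many entries of [L] and of
   [M]. *)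
apply/allP => p; rewrite -map_cat => /mapP[c _ ->].
have := sq_key_lt c; case: (sq_key c) => a b ab.
apply/eqP; have := l0 _ _ ab; rewrite lx //=.
move: (count_mem _ _) (count_mem _ _) => p1 p2; lia.
Qed.

Lemma qcls_eq x y : bperm x =1 bperm y ->
  (forall a b, a < b -> link x a b = link y a b) -> qcls x = qcls y.
Proof.
move=> exy lxy; have {}lxy a b : link x a b = link y a b.
  by have [/lxy //|/lxy|->] := ltngtP a b; rewrite ?linkaa // ![link _ b _]linkC.
apply/eqP; rewrite -(can_eq (mulgK (qcls y)^-1)) mulgV -qclsV -qclsM; apply/eqP.
apply: Pinf_link0_qcls1 => [|a b _]; first by apply/PinfP => a; rewrite bpermM exy bpermK.
by rewrite linkM linkV lxy !exy !bpermK; lia.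
Qed.

(** * The image of the permutation and crossing numbers *)

Lemma sq_key_surj a b : a < b -> exists c, sq_key c = (a, b).
Proof.
(* The first factor carries [a] to 0 and fixes [b], as [a < b]; the second carries [b] to 1 and
   fixes 0. The inverse of [y] is the witness. *)
move=> ab; pose y := desc 0 a * desc 1 b.-1.
have ya : bperm y a = 0.
  rewrite bpermM [bperm (desc 0 a) a](bperm_desc 0 a).
  by apply: (@seg_out 1 b); [apply: seg_desc; lia | lia].
have yb : bperm y b = 1%N.
  rewrite bpermM (@seg_out 0 a (desc 0 a)); [|exact: seg_desc|lia].
  by have := bperm_desc 1 b.-1; rewrite add1n prednK //; lia.
by exists y^-1; rewrite /sq_key -{1 3}ya -yb !bpermK; congr (_, _); lia.
Qed.

Lemma Pinf_link_mul x (k : int) : x \in Pinf ->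
  exists2 y, y \in Pinf & forall a b, link y a b = (k * link x a b)%R.
Proof.
have N (n : nat) : x \in Pinf ->
    exists2 y, y \in Pinf & forall a b, link y a b = (n%:Z * link x a b)%R.
  move=> Px; elim: n => [|n [y Py ly]].
    exists 1 => [|a b]; first by apply/PinfP => a; rewrite bperm1.
    by rewrite link1 GRing.mul0r.
  exists (x * y) => [|a b]; first exact: PinfM.
  by rewrite link_PinfM // ly; lia.
case: k => n Px; first exact: N.
have [y Py ly] := N n.+1 Px; exists y^-1 => [|a b]; first exact: PinfV.
by rewrite link_PinfV // ly NegzE; lia.
Qed.

(** A suitable [sq c] has crossing number 2 at one pair and 0 at all others, so even values can be
    prescribed pair by pair. *)
Lemma Pinf_link_surj (u : nat -> nat -> int) (s : seq (nat * nat)) :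
  (forall a b, a < b -> exists k, u a b = (k *+ 2)%R) ->
  exists2 d, d \in Pinf &
    forall a b, a < b -> link d a b = if (a, b) \in s then u a b else 0%R.
Proof.
move=> u2; elim: s => [|[a b] s [d Pd ld]].
  by exists 1 => [|a b _]; [apply/PinfP => a; rewrite bperm1 | rewrite link1].
have [ab_s|ab_s] := boolP ((a, b) \in s).
  exists d => // a' b' ab'; rewrite inE ld //.
  by case: eqP => [->|//]; rewrite ab_s.
have [ab|ba] := ltnP a b; last first.
  exists d => // a' b' ab'; rewrite inE ld // xpair_eqE.
  by have -> : (a' == a) && (b' == b) = false by lia.
have [c kc] := sq_key_surj ab; have [k uk] := u2 _ _ ab.
have [y Py ly] := Pinf_link_mul k (sq_Pinf c).
exists (y * d) => [|a' b' ab']; first exact: PinfM.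
rewrite link_PinfM // ly link_sq // ld // kc inE eq_sym.
case: eqP => [[-> ->]|_]; first by rewrite (negPf ab_s) uk /=; lia.
by rewrite /= GRing.mul0rn GRing.mulr0 GRing.add0r.
Qed.

(** Any lift [x] of [f] has the right parities, so it differs from the target by even numbers,
    nonzero at finitely many pairs only; a pure braid [d] corrects them. *)
Lemma bperm_link_surj n (f : nat -> nat) (v : nat -> nat -> int) :
  injective f -> (forall a, n <= a -> f a = a) ->
  (forall a b, a < b -> n <= b -> v a b = 0%R) ->
  (forall a b, a < b -> exists k : int, v a b = (k *+ 2 + (~~ (f a < f b))%:Z)%R) ->
  exists2 x, bperm x =1 f & forall a b, a < b -> link x a b = v a b.
Proof.
move=> fI fout vout vpar.
have [a an|x _ ex] := @bperm_surj 0 n f fI; first by apply: fout; lia.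
have [N lN] := link_fin x.
pose s := [seq (a, b) | a <- iota 0 (maxn n N), b <- iota 0 (maxn n N)].
have [|d Pd ld] := @Pinf_link_surj (fun a b => v a b - link x a b)%R s.
  move=> a b ab; have [k ->] := vpar _ _ ab.
  have [|k' ->] := @link_parity x a b; first by lia.
  by exists (k - k')%R; rewrite !ex ab /=; lia.
exists (d * x) => [a|a b ab]; first by rewrite bpermM (PinfP _ Pd).
rewrite link_PinfM // ld //; case: ifP => [_|/negP nab]; first by lia.
have bN : maxn n N <= b.
  rewrite leqNgt; apply/negP => bN; apply: nab.
  by apply/allpairsP; exists (a, b); rewrite !mem_iota /=; split=> //; lia.
by rewrite lN ?vout //; lia.
Qed.

(** * Absence of elements of even order *)

Lemma Binf_quot_no_even (x : Binf_quot) n : has_order x n -> odd n.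
Proof.
move=> [n_gt0 xn xmin]; apply/negP => /negP n_even.
have en : n = n./2 + n./2 by lia.
have [z ez] : exists z, qcls z = x ^+ n./2.
  by elim/qg_classW: (x ^+ n./2) => z; exists z.
have y2 : qcls (z * z) = 1 by rewrite qclsM ez -expgD -en.
have y1 : qcls z <> 1.
  by rewrite ez => /xmin; lia.
have [/PinfP p2 l2] := comm_Pinf_link (proj1 (qg_class_eq1 _ _) y2).
(* If [z] is pure, twice its crossing numbers vanish, so they vanish and [z] has trivial class.
   Otherwise [z] exchanges two strands, and their crossing number is odd. *)
have [Pz|/PinfP nPz] := boolP (z \in Pinf).
  apply: y1; apply: Pinf_link0_qcls1 => // a b _.
  by have := l2 a b; rewrite link_PinfM //; lia.
have [a /eqP az] : exists a, bperm z a <> a by apply/existsNP.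
have pa : bperm z (bperm z a) = a by have := p2 a; rewrite bpermM.
have := l2 a (bperm z a); rewrite linkM pa [X in (_ + X)%R]linkC.
have [|k ->] := @link_parity z a (bperm z a); first by rewrite eq_sym.
rewrite pa; have -> : (a < bperm z a) (+) (bperm z a < a) by lia.
by lia.
Qed.

(** * Embedding of groups of odd order *)

Section RegularEmbedding.
Variables (G : finGroupType) (oddG : odd #|G|).

Let n := #|G|.
Let elt (a : nat) : G := nth 1 (enum G) a.
Let rk (g : G) : nat := index g (enum G).
Let sizeG : size (enum G) = n. Proof. by rewrite /n cardE. Qed.

Let rk_lt g : rk g < n.
Proof. by rewrite -sizeG index_mem mem_enum. Qed.

Let rkK : cancel rk elt.
Proof. by move=> g; rewrite /elt nth_index // mem_enum. Qed.

Let eltK a : a < n -> rk (elt a) = a.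
Proof. by move=> an; rewrite /rk index_uniq ?enum_uniq ?sizeG. Qed.

(** Translation is on the right to match the order of composition in [bpermM]. *)
Let rmul (g : G) (a : nat) : nat := if a < n then rk (elt a * g) else a.

Let rmulM g h a : rmul (g * h) a = rmul h (rmul g a).
Proof.
rewrite /rmul; case: (ltnP a n) => an; first by rewrite rk_lt rkK mulgA.
by rewrite ltnNge an.
Qed.

Let rmul1 a : rmul 1 a = a.
Proof. by rewrite /rmul mulg1; case: ltnP => // /eltK. Qed.

Let rmulK g : cancel (rmul g) (rmul g^-1).
Proof. by move=> a; rewrite -rmulM mulgV rmul1. Qed.

Let rmul_lt g a : (rmul g a < n) = (a < n).
Proof. by rewrite /rmul; case: (ltnP a n) => an; rewrite ?rk_lt // ltnNge an. Qed.

(* The pair {a, b} is oriented by choosing one of x, x^-1 for x = a b^-1; this is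
   invariant under right translations, and x != x^-1 because #|G| is odd. *)
Let orient (x : G) : bool := rk x < rk x^-1.

Let orientV x : x != 1 -> orient x^-1 = ~~ orient x.
Proof.
move=> x1; rewrite /orient invgK -leqNgt ltn_neqAle andb_idl // => _.
apply: contra x1 => /eqP/(can_inj rkK) xV.
have x2 : x ^+ 2 = 1 by rewrite expgS expg1 -{1}xV mulVg.
have ox : odd #[x].
  by apply: dvdn_odd oddG; rewrite -cardsT; apply: cardSg (subsetT <[x]>).
rewrite -(expg_order x) -[#[x]]odd_double_half ox -muln2 mulnC.
by rewrite expgS expgM x2 expg1n mulg1.
Qed.

(** This is the cochain c: it compares the chosen orientation with the standard one, which makes it
    symmetric in [a] and [b] ([defectC]). *)
Let defect (a b : nat) : bool :=
  (b < n) && ((a < b) (+) orient (elt a * (elt b)^-1)).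

(** As the orientation is translation invariant, translating a pair changes its defect exactly when
    it reverses the order of the pair; this is the parity required by [bperm_link_surj]. *)
Let defect_rmul g a b : a < b -> b < n ->
  defect (rmul g a) (rmul g b) =
  (rmul g a < rmul g b) (+) orient (elt a * (elt b)^-1).
Proof.
move=> ab bn; have an := ltn_trans ab bn.
rewrite /defect rmul_lt bn /= {3 4}/rmul an bn !rkK.
by rewrite invgM mulgA mulgK.
Qed.

Let defectC a b : a < n -> b < n -> a != b -> defect a b = defect b a.
Proof.
move=> an bn ab; rewrite /defect an bn /=.
have x1 : elt a * (elt b)^-1 != 1.
  rewrite mulg_eq1 invgK; apply: contra ab => /eqP e.
  by rewrite -(eltK an) e eltK.
have -> : elt b * (elt a)^-1 = (elt a * (elt b)^-1)^-1 by rewrite invgM invgK.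
rewrite orientV //; have -> : (b < a) = ~~ (a < b) by lia.
by rewrite addbN addNb negbK.
Qed.

(** The difference g.c - c. It is only evaluated at [a < b], so [b < n] puts both indices in
    range. *)
Let coboundary g a b : int :=
  if b < n then ((defect (rmul g a) (rmul g b))%:Z - (defect a b)%:Z)%R else 0%R.

Let rmul_big g a b : a < b -> n <= b -> rmul g a < rmul g b.
Proof.
move=> ab bn; rewrite {2}/rmul [b < n]ltnNge bn /=.
have [an|na] := ltnP a n; first by apply: leq_trans bn; rewrite rmul_lt.
by rewrite /rmul [a < n]ltnNge na.
Qed.

Lemma regular_lift g : exists2 x, bperm x =1 rmul g &
  forall a b, a < b -> link x a b = coboundary g a b.
Proof.
apply: (@bperm_link_surj n).
- exact: can_inj (rmulK g).
- by move=> a an; rewrite /rmul ltnNge an.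
- by move=> a b _ bn; rewrite /coboundary ltnNge bn.
move=> a b ab; rewrite /coboundary; case: (ltnP b n) => bn; last first.
  by exists 0%R; rewrite rmul_big.
rewrite defect_rmul // /defect bn ab /=.
move: (rmul g a < _) (orient _) => t o.
by exists (- (~~ t && ~~ o)%:Z)%R; case: t; case: o.
Qed.

(** The condition [a < b] is removed by symmetry, because a translated pair need not be in
    increasing order. *)
Let link_lift x g a b : bperm x =1 rmul g ->
    (forall a b, a < b -> link x a b = coboundary g a b) ->
    a != b -> a < n -> b < n ->
  link x a b = ((defect (rmul g a) (rmul g b))%:Z - (defect a b)%:Z)%R.
Proof.
move=> ex lx ab an bn; have [lab|lba|eab] := ltngtP a b; last by rewrite eab eqxx in ab.
  by rewrite lx // /coboundary bn.
rewrite linkC lx // /coboundary an (defectC bn an) 1?eq_sym //.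
by rewrite (@defectC (rmul g b)) ?rmul_lt // (can_eq (rmulK g)) eq_sym.
Qed.

Lemma odd_group_embedding :
  exists2 f : G -> Binf_quot, {morph f : x y / x * y} & injective f.
Proof.
have /choice[F HF] g : exists x, bperm x =1 rmul g /\
    forall a b, a < b -> link x a b = coboundary g a b.
  by have [x] := regular_lift g; exists x.
exists (qcls \o F) => [g h|g h /= egh].
  have [[pg lg] [ph lh]] := (HF g, HF h); have [pgh lgh] := HF (g * h).
  rewrite /= -qclsM; apply: qcls_eq => [a|a b ab].
    by rewrite bpermM pgh rmulM ph pg.
  rewrite linkM !pg; have [bn|nb] := ltnP b n; last first.
    rewrite lgh // lg // lh ?rmul_big // /coboundary.
    by rewrite rmul_lt [b < n]ltnNge nb.
  have an := ltn_trans ab bn; have ab' : a != b by rewrite ltn_eqF.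
  (* The crossing numbers of the product telescope. *)
  rewrite (link_lift pgh) // (link_lift pg) // (link_lift ph) ?rmul_lt //.
    by rewrite !rmulM; lia.
  by rewrite (can_eq (rmulK g)).
(* The permutation alone gives injectivity: that of [F g] sends [rk 1] to [rk g]. *)
have : qcls (F g * (F h)^-1) = 1 by rewrite qclsM qclsV egh mulgV.
move=> /qg_class_eq1/comm_Pinf_link[/PinfP p1 _].
have := bpermKV (F h) (bperm (F g) (rk 1)); rewrite -[bperm (F h)^-1 _]bpermM p1.
rewrite (HF h).1 (HF g).1 /rmul rk_lt rkK !mul1g => /(can_inj rkK).
exact: esym.
Qed.

End RegularEmbedding.

Theorem proposition16 :
  (forall G : finGroupType, odd #|G| ->
     exists H : {pred Binf_quot}, group_closed H /\ iso_to_sub G H) /\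
  ~ (exists (x : Binf_quot) (n : nat), has_order x n /\ ~~ odd n).
Proof.
split=> [G oddG|[x [n [/Binf_quot_no_even ->]]] //].
have [f fM fI] := odd_group_embedding oddG.
have f1 : f 1 = 1 by apply: (mulgI (f 1)); rewrite -fM !mulg1.
have fV x : f x^-1 = (f x)^-1 by apply: (mulgI (f x)); rewrite -fM !mulgV f1.
pose H : {pred Binf_quot} := [pred y | `[< exists x, f x = y >]].
exists H; split.
  split; first by apply/asboolP; exists 1.
  move=> _ _ /asboolP[x <-] /asboolP[y <-].
  by apply/asboolP; exists (x * y^-1); rewrite fM fV.
pose fmul := isMultiplicative.Build _ _ f fM.
pose phi : {multiplicative G -> Binf_quot} := HB.pack f fmul.
by exists phi; split=> // y; split=> [/asboolP|?]; last apply/asboolP.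
Qed.
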